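(* Let $L$ be a finite distributive lattice and $x\in L$. If $x$ is covered by at least three elements of $L$ and $x$ covers at least three meet-irreducible elements of $L$, then $L$ is non-matchable.
   Context: An element of a finite lattice is meet-irreducible if it is covered by exactly one element. Let $G$ be a finite plane bipartite graph with a perfect matching, vertices properly colored black and white. A cell is an inner face whose boundary is a cycle. For a perfect matching $M$, an $M$-alternating cycle is proper if, traversing it clockwise, every edge in $M$ goes from its white end to its black end. The $Z$-transformation digraph $\vec{Z}(G)$ has vertex set $\mathcal{M}(G)$ (the perfect matchings of $G$) and an arc $M_1\to M_2$ iff $M_1\oplus M_2$ is the edge set of a cell that is a proper $M_1$-alternating cycle; $M_1\le M_2$ iff there is a directed path from $M_2$ to $M_1$. $G$ is elementary if connected and every edge lies in a perfect matching; $G$ is weakly elementary if for every cycle $C$ with $G-V(C)$ having a perfect matching, $C$ together with its interior forms an elementary subgraph. For plane weakly elementary bipartite $G$, $(\mathcal{M}(G),\le)$ is a finite distributive lattice. A finite distributive lattice $L$ is matchable if $L\cong\mathcal{M}(G)$ for some plane weakly elementary bipartite graph $G$; otherwise it is non-matchable. *)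

(* Defs.v *)
From mathcomp Require Import all_boot all_order.
From Stdlib Require Import Relations.Relation_Operators.
Set Implicit Arguments. Unset Strict Implicit. Unset Printing Implicit Defensive.

(* A finite simple plane graph, possibly disconnected, given combinatorially.
   - [rot v u] is the neighbour of [v] following [u] counterclockwise around [v];
     [rot v] permutes the neighbours of [v] cyclically.
   - [side u v] is the face to the right of the edge [uv] traversed from [u] to [v].
     Walking along a face kept on the right, one goes on from [uv] to the edge
     from [v] to [rot v u].
   - A face of a disconnected plane graph may have several boundary walks, so
     faces are not merely the orbits of the map (u, v) |-> (v, rot v u): they form
     a type of their own, and [side] records which boundary walks belong to the
     same face, hence which components are nested in which faces.
   - The last two fields say that the surface is the sphere: it is connected,
     and Euler's formula V - E + F = 1 + (number of components) holds.  For a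
     connected graph this is planarity of the rotation system; in general each
     component has genus 0 and the incidence structure between components and
     faces is a tree.
   - The distinguished face [outer] is the unbounded one.
   By [pg_connected] there is no isolated vertex; this excludes no graph that has
   a perfect matching. *)
Record plane_graph := PlaneGraph {
  vertex : finType;
  adj : rel vertex;
  adj_sym : symmetric adj;
  adj_irr : irreflexive adj;
  rot : vertex -> vertex -> vertex;
  rot_adj : forall v u, adj v u -> adj v (rot v u);
  rot_cyclic : forall v u w, adj v u -> adj v w -> fconnect (rot v) u w;
  face : finType;
  outer : face;
  side : vertex -> vertex -> face;
  side_rot : forall u v, adj u v -> side v (rot v u) = side u v;
  pg_connected : forall x y : vertex + face,
    connect (fun a b => match a, b with
             | inl u, inl v => adj u v
             | inl u, inr f | inr f, inl u =>
                 [exists v, adj u v && (side u v == f)]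
             | inr _, inr _ => false
             end) x y;
  pg_euler : #|vertex| + #|face|
    = #|[set [set p.1; p.2] | p : vertex * vertex & adj p.1 p.2]|
      + n_comp adj (@predT vertex) + 1
}.

Section Graph.
Variable G : plane_graph.
Local Notation V := (vertex G).
Implicit Types (u v : V) (W : {set V}) (H M C : {set {set V}}) (f g : face G).

Definition edges : {set {set V}} :=
  [set [set p.1; p.2] | p : V * V & adj p.1 p.2].

(* A subgraph is given by its vertex set [W] and its edge set [H]. *)
Definition perfect_matching W H M : bool := (M \subset H) && partition M W.

Definition connected W H : Prop :=
  forall u v, u \in W -> v \in W ->
    connect (fun a b => [set a; b] \in H) u v.

Definition elementary W H : Prop :=
  connected W H /\
  forall e, e \in H -> exists2 M, perfect_matching W H M & e \in M.

(* Cycles are represented by their edge sets, so that the vertex set of the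
   cycle [C] is [cover C]. *)
Definition is_cycle C : Prop :=
  exists s : seq V, [/\ 2 < size s, ucycle (@adj G) s
    & C = [set [set x; next s x] | x in s]].

(* The faces inside [C] are those that cannot be reached from the outer face by
   crossing edges not in [C]. *)
Definition inside C f : bool :=
  ~~ connect (fun f1 f2 => [exists u, exists v,
        [&& adj u v, [set u; v] \notin C, side u v == f1 & side v u == f2]])
      (outer G) f.

(* The edges of the subgraph formed by [C] together with its interior. *)
Definition disc C : {set {set V}} :=
  [set [set p.1; p.2] | p : V * V &
     adj p.1 p.2 && (([set p.1; p.2] \in C)
       || inside C (side p.1 p.2) && inside C (side p.2 p.1))].

Definition weakly_elementary : Prop :=
  forall C, is_cycle C ->
    (exists M, perfect_matching (~: cover C)
                 [set e in edges | e \subset ~: cover C] M) ->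
    elementary (cover (disc C)) (disc C).

Definition boundary f : {set {set V}} :=
  [set [set p.1; p.2] | p : V * V & adj p.1 p.2 && (side p.1 p.2 == f)].

Definition cell f : Prop := f <> outer G /\ is_cycle (boundary f).

(* [c v] is true when [v] is white and false when [v] is black. *)
Definition proper_coloring (c : V -> bool) : Prop :=
  forall u v, adj u v -> c u != c v.

Definition alternating M C : Prop :=
  is_cycle C /\
  forall e1 e2, e1 \in C -> e2 \in C -> e1 != e2 -> ~~ [disjoint e1 & e2] ->
    (e1 \in M) != (e2 \in M).

(* Traversing [C] clockwise means keeping its interior on the right. *)
Definition proper_alternating (c : V -> bool) M C : Prop :=
  alternating M C /\
  forall u v, adj u v -> [set u; v] \in C -> inside C (side u v) ->
    [set u; v] \in M -> c u /\ ~~ c v.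

Definition matching : Type := {M : {set {set V}} | perfect_matching setT edges M}.

Definition symdiff (M1 M2 : {set {set V}}) : {set {set V}} :=
  (M1 :\: M2) :|: (M2 :\: M1).

Definition Zarc (c : V -> bool) (M1 M2 : matching) : Prop :=
  exists f, [/\ cell f, symdiff (val M1) (val M2) = boundary f
    & proper_alternating c (val M1) (boundary f)].

Definition Zle (c : V -> bool) (M1 M2 : matching) : Prop :=
  clos_refl_trans matching (Zarc c) M2 M1.

End Graph.

Section Lattice.
Variables (disp : Order.disp_t) (L : finDistrLatticeType disp).
Implicit Types x y z : L.

Definition covered_by x y : bool :=
  (x < y)%O && [forall z, ~~ ((x < z)%O && (z < y)%O)].

Definition meet_irreducible x : bool := #|[set y | covered_by x y]| == 1.

(* An isomorphism of lattices is the same thing as an isomorphism of their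
   orders. *)
Definition matchable : Prop :=
  exists (G : plane_graph) (c : vertex G -> bool),
    [/\ proper_coloring c, inhabited (matching G), weakly_elementary G
      & exists phi : L -> matching G,
          bijective phi /\ forall x y, (x <= y)%O <-> Zle c (phi x) (phi y)].

End Lattice.

(* Main.v *)
Require Import Defs.
From mathcomp Require Import all_boot all_order zify.
From Stdlib Require Import Relations.Relation_Operators Relations.Operators_Properties.
(* [rot] is the rotation system of a plane graph, not [seq.rot]. *)
Import Defs Order.POrderTheory.
Set Implicit Arguments. Unset Strict Implicit. Unset Printing Implicit Defensive.

(** Let [M] be the perfect matching corresponding to [x].  The elements covering
    [x] yield three cells [F i], and the meet-irreducible elements [y j] covered
    by [x] yield three cells [H j], all of them [M]-alternating and distinct.  If
    [F i] and [H j] had no common vertex, one could still flip [F i] in the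
    matching of [y j], so [y j] would have an upper bound not above [x]: the
    number of times a path of flips uses each cell depends only on its ends.
    Hence [F i] and [H j] share a vertex, thus its [M]-edge, and the dual graph
    contains K_{3,3}.

    That is impossible.  For [S] a set of edges, let [c(S)] be the number of
    components of [(V, S)] and [d(S)] that of the dual graph with edge set [S].
    Adding an edge that joins two components of [S] does not increase
    [d(E \ S)], so [|V| + d(E \ S) <= |S| + c(S) + 1].  If [K] is the set of the
    nine edges of the K_{3,3}, this and Euler's formula give
    [c(E \ K) >= c(E) + 4], so at least five components of [E \ K] meet an edge
    of [K] leaving them.  The edges of [K] leaving a component form an even
    subgraph of K_{3,3}, so there are at least four of them; but
    [5 * 4 > 2 * 9]. *)

(** * Counting connected components *)

Section Components.
Variable T : finType.
Implicit Types e : rel T.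

Lemma n_comp_predT e : n_comp e predT = #|[set x | roots e x]|.
Proof. by apply: eq_card => x; rewrite !inE andbT. Qed.

Lemma connect_invariant (rT : Type) e (h : T -> rT) :
  (forall a b, e a b -> h a = h b) -> forall a b, connect e a b -> h a = h b.
Proof.
move=> eh a b /connectP[p]; elim: p a => [|z p IHp] a /=; first by move=> _ ->.
by case/andP=> /eh-> /IHp h1 /h1.
Qed.

(** Since [h] is constant on components, it takes all its values on the roots. *)
Lemma card_codom_n_comp (rT : finType) e (h : T -> rT) : symmetric e ->
  (forall a b, e a b -> h a = h b) -> #|h @: setT| <= n_comp e predT.
Proof.
move=> es eh; rewrite n_comp_predT.
apply: leq_trans (leq_imset_card h [set x | roots e x]).
apply/subset_leq_card/subsetP => _ /imsetP[x _ ->].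
rewrite (connect_invariant eh (connect_root e x)).
by apply: imset_f; rewrite inE roots_root //; apply: sym_connect_sym.
Qed.

Lemma n_comp_connected e :
  (forall a b, connect e a b) -> n_comp e predT <= 1.
Proof.
move=> ec; have es : connect_sym e by move=> a b; rewrite !ec.
rewrite n_comp_predT; apply/card_le1_eqP => a b; rewrite !inE => ra rb.
by apply/eqP; rewrite eq_sym -(eqP ra) -(eqP rb) root_connect ?ec.
Qed.

Variables (e e' : rel T) (u v : T).
Hypotheses (es : symmetric e) (es' : symmetric e') (see' : subrel e e').
Hypothesis new_edge : forall a b, e' a b ->
  [\/ e a b, (a, b) = (u, v) | (a, b) = (v, u)].

(** A path that uses the new edge stays, before and after it, in the components of [u] and [v]. *)
Lemma connect_add_edge a b : connect e' a b -> connect e a b \/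
  (connect e u a \/ connect e v a) /\ (connect e u b \/ connect e v b).
Proof.
have sym := sym_connect_sym es.
case/connectP=> p; elim: p a => [|z p IHp] a /=; first by move=> _ ->; left.
case/andP=> /new_edge az zp bE.
case: (IHp z zp bE) => [zb|[zU bU]].
  case: az => [az|[-> zE]|[-> zE]]; first by left; apply: connect_trans zb; apply: connect1.
    by right; split; [left | right; rewrite -zE].
  by right; split; [right | left; rewrite -zE].
right; split=> //; case: az => [az|[-> _]|[-> _]]; [|by left|by right].
by case: zU => h; [left|right]; apply: connect_trans h _; rewrite sym; apply: connect1.
Qed.

(** Only the components of [u] and [v] can merge. Once the root of [v] is discarded, [root e']
    separates the remaining roots of [e]. *)
Lemma n_comp_add_edge : n_comp e predT <= (n_comp e' predT).+1.
Proof.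
have sym := sym_connect_sym es; have sym' := sym_connect_sym es'.
rewrite !n_comp_predT.
rewrite (cardsD1 (root e v)) inE roots_root // add1n ltnS.
rewrite -(@card_in_imset _ _ (root e')); last first.
  move=> a b; rewrite !inE => /andP[av ra] /andP[bv rb] /eqP.
  rewrite root_connect // => /connect_add_edge[ab|].
    by apply/eqP; rewrite -(eqP ra) -(eqP rb) root_connect.
  have root_u z : z != root e v -> roots e z -> connect e u z \/ connect e v z ->
      z = root e u.
    move=> zv /eqP rz [h|h]; first by rewrite -rz; apply/eqP; rewrite root_connect // sym.
    by case/eqP: zv; rewrite -rz; apply/eqP; rewrite root_connect // sym.
  by case=> /(root_u _ av ra)-> /(root_u _ bv rb)->.
apply/subset_leq_card/subsetP => _ /imsetP[x _ ->].
by rewrite inE roots_root.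
Qed.

Lemma n_comp_add_inner_edge : connect e u v -> n_comp e predT = n_comp e' predT.
Proof.
move=> uv; apply: eq_n_comp => a b; have sym := sym_connect_sym es.
apply/idP/idP; first by apply: connect_sub => {}a {}b /see'/connect1.
apply: connect_sub => {}a {}b /new_edge[/connect1 //|[-> ->] //|[-> ->]].
by rewrite sym.
Qed.

End Components.

(** * Non-planarity of K_{3,3} *)

Lemma sum_stable_injective (T : finType) (A : {set T}) (h : T -> T) (F : T -> nat) :
  {in A &, injective h} -> (forall x, x \in A -> h x \in A) ->
  \sum_(x in A) F (h x) = \sum_(x in A) F x.
Proof.
move=> hi hA.
suff {2}<- : h @: A = A by rewrite big_imset.
apply/eqP; rewrite eqEcard card_in_imset // leqnn andbT.
by apply/subsetP => _ /imsetP[x xA ->]; apply: hA.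
Qed.

(** * Rotation systems, dual graphs and Euler's inequality *)

Section PlaneGraph.
Variable G : plane_graph.
Local Notation V := (vertex G).
Implicit Types (u v w : V) (S K : {set {set V}}) (W : {set V}) (f : face G).

Definition incident S : rel V := fun a b => [set a; b] \in S.

Definition dual_adj S : rel (face G) := fun f1 f2 =>
  [exists u, exists v,
     [&& adj u v, [set u; v] \in S, side u v == f1 & side v u == f2]].

Lemma incident_sym S : symmetric (incident S).
Proof. by move=> a b; rewrite /incident setUC. Qed.

Lemma dual_adjP S f1 f2 :
  reflect (exists u v, [/\ adj u v, [set u; v] \in S, side u v = f1 & side v u = f2])
    (dual_adj S f1 f2).
Proof.
apply: (iffP existsP) => [[u /existsP[v /and4P[? ? /eqP ? /eqP ?]]]|[u [v [? ? ? ?]]]].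
  by exists u, v.
by exists u; apply/existsP; exists v; apply/and4P; split=> //; apply/eqP.
Qed.

Lemma dual_adj_sym S : symmetric (dual_adj S).
Proof.
have sub f1 f2 : dual_adj S f1 f2 -> dual_adj S f2 f1.
  case/dual_adjP=> u [v [uv uvS <- <-]]; apply/dual_adjP; exists v, u.
  by rewrite adj_sym setUC.
by move=> f1 f2; apply/idP/idP => /sub.
Qed.

Lemma set2_eqP (T : finType) (a b u v : T) :
  [set a; b] = [set u; v] -> (a, b) = (u, v) \/ (a, b) = (v, u).
Proof.
move=> E; have: (a \in [set u; v]) && (b \in [set u; v]).
  by rewrite -E !inE !eqxx orbT.
have: (u \in [set a; b]) && (v \in [set a; b]) by rewrite E !inE !eqxx orbT.
rewrite !inE => /andP[h1 h2] /andP[h3 h4].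
case/orP: h3 h4 h1 h2 => /eqP-> /orP[]/eqP->; rewrite ?orbb.
- by move=> _ /eqP->; left.
- by left.
- by right.
- by move/eqP=> ->; left.
Qed.

Lemma mem_edges u v : ([set u; v] \in edges G) = adj u v.
Proof.
apply/imsetP/idP => [[[a b]]|uv]; last by exists (u, v); rewrite ?inE.
rewrite inE /= => ab /set2_eqP[[-> ->] //|[-> ->]].
by rewrite adj_sym.
Qed.

Lemma edgesP e : reflect (exists u v, adj u v /\ e = [set u; v]) (e \in edges G).
Proof.
apply: (iffP imsetP) => [[[a b]]|[u [v [uv ->]]]].
  by rewrite inE /= => ab ->; exists a, b.
by exists (u, v); rewrite ?inE.
Qed.

Lemma iter_rot_adj n v u : adj v u -> adj v (iter n (rot v) u).
Proof. by move=> uv; elim: n => //= n; apply: rot_adj. Qed.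

(** By [rot_cyclic], some iterate of [rot v] leads from [rot v w] back to [w]; so [rot v] is onto
    the finite set of neighbours, hence injective there. *)
Lemma rot_inj v : {in [pred u | adj v u] &, injective (rot v)}.
Proof.
suff: #|rot v @: [set u | adj v u]| == #|[set u | adj v u]|.
  by move/imset_injP => h a b va vb; apply: h; rewrite inE.
rewrite eqn_leq leq_imset_card; apply/subset_leq_card/subsetP => w.
rewrite inE => vw; have := rot_cyclic (rot_adj vw) vw.
case/iter_findex; set n := findex _ _ _ => <-; rewrite -iterSr iterS.
by apply: imset_f; rewrite inE iter_rot_adj.
Qed.

Definition darts : {set V * V} := [set d | adj d.1 d.2].

(* The left face of a dart is the right face of the next dart around its source;
   darts inside [W] cancel with their reversals. *)
Lemma cut_balance W (X : pred (face G)) :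
  \sum_(d in darts | (d.1 \in W) && (d.2 \notin W)) X (side d.1 d.2) =
  \sum_(d in darts | (d.1 \in W) && (d.2 \notin W)) X (side d.2 d.1).
Proof.
have all : \sum_(d in [set d in darts | d.1 \in W]) X (side d.2 d.1) =
           \sum_(d in [set d in darts | d.1 \in W]) X (side d.1 d.2).
  rewrite -(sum_stable_injective (h := fun d => (d.1, rot d.1 d.2)) (fun d => X (side d.1 d.2))) /=.
  - by apply: eq_bigr => -[a b]; rewrite !inE /= => /andP[ab _]; rewrite side_rot // adj_sym.
  - move=> [a b] [a' b']; rewrite !inE /= => /andP[ab _] /andP[ab' _] [aE].
    by rewrite -aE in ab' *; move/(rot_inj ab ab')->.
  - by move=> [a b]; rewrite !inE /= => /andP[ab ->]; rewrite rot_adj.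
have inner : \sum_(d in [set d in darts | (d.1 \in W) && (d.2 \in W)]) X (side d.2 d.1) =
             \sum_(d in [set d in darts | (d.1 \in W) && (d.2 \in W)]) X (side d.1 d.2).
  rewrite -(sum_stable_injective (h := fun d => (d.2, d.1)) (fun d => X (side d.1 d.2))) //.
  - by move=> [a b] [a' b'] _ _ [-> ->].
  - by move=> [a b]; rewrite !inE /= adj_sym => /and3P[-> -> ->].
have split F : \sum_(d in [set d in darts | d.1 \in W]) F d =
   \sum_(d in [set d in darts | (d.1 \in W) && (d.2 \in W)]) F d +
   \sum_(d in darts | (d.1 \in W) && (d.2 \notin W)) F d.
  rewrite (bigID (fun d : V * V => d.2 \in W)) /=.
  by congr (_ + _); apply: eq_bigl => d; rewrite !inE -!andbA.
by move: all; rewrite !split inner => /addnI->.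
Qed.

(** [(d.2, rot d.2 d.1)] is the dart after [d] on the walk along [f]: targets are the sources of the
    next darts. *)
Lemma face_balance f W :
  \sum_(d in darts | side d.1 d.2 == f) (d.1 \in W) =
  \sum_(d in darts | side d.1 d.2 == f) (d.2 \in W).
Proof.
pose A := [set d in darts | side d.1 d.2 == f].
have AE F : \sum_(d in darts | side d.1 d.2 == f) F d = \sum_(d in A) F d :> nat.
  by apply: eq_bigl => d; rewrite !inE.
rewrite !AE -(sum_stable_injective (h := fun d => (d.2, rot d.2 d.1)) (fun d => nat_of_bool (d.1 \in W))) //=.
- move=> [a b] [a' b']; rewrite !inE /= => /andP[ab _] /andP[ab' _] [bE].
  rewrite adj_sym in ab; rewrite adj_sym -bE in ab'; rewrite -bE.
  by move/(rot_inj ab ab')->.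
- move=> [a b]; rewrite !inE /= => /andP[ab /eqP <-].
  by rewrite side_rot // eqxx rot_adj // adj_sym.
Qed.

(** Crossing the edges at a vertex one after another links all faces around it; [pg_connected] then
    links the faces of the whole graph. *)
Lemma dual_connected f1 f2 : connect (dual_adj (edges G)) f1 f2.
Proof.
have sym := sym_connect_sym (@dual_adj_sym (edges G)).
have cross u v : adj u v -> connect (dual_adj (edges G)) (side u v) (side v u).
  by move=> uv; apply/connect1/dual_adjP; exists u, v; rewrite mem_edges.
have around u v w : adj u v -> adj u w -> connect (dual_adj (edges G)) (side u v) (side u w).
  move=> uv uw; have /iter_findex<- := rot_cyclic uv uw.
  elim: (findex _ _ _) => //= n IHn; apply: connect_trans IHn _.
  have un := iter_rot_adj n uv; rewrite side_rot 1?adj_sym //.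
  by apply: cross.
(* [at_ x f] means that [f] is reached in the dual from [x], where a vertex stands for the faces
   around it. It is carried backwards along a path of [pg_connected]. *)
pose at_ (x : V + face G) f := match x with
  | inl u => exists2 v, adj u v & connect (dual_adj (edges G)) (side u v) f
  | inr f' => connect (dual_adj (edges G)) f' f end.
have step (x y : V + face G) : (match x, y with
             | inl u, inl v => adj u v
             | inl u, inr f | inr f, inl u =>
                 [exists v, adj u v && (side u v == f)]
             | inr _, inr _ => false
             end) -> forall f, at_ y f -> at_ x f.
  case: x y => [u|f] [v|f'] //=.
  - move=> uv f [w vw h]; exists v => //; apply: connect_trans h.
    have vu : adj v u by rewrite adj_sym.
    by rewrite -(side_rot uv); apply: around (rot_adj vu) vw.
  - by case/existsP=> v /andP[uv /eqP<-] f h; exists v.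
  - case/existsP=> w /andP[vw /eqP<-] f1' [w' vw' h]; apply: connect_trans h.
    exact: around.
have: at_ (inr f2) f2 by apply: connect0.
suff: at_ (inr f2) f2 -> at_ (inr f1) f2 by [].
case/connectP: (pg_connected (inr f1) (inr f2)) => p.
elim: p (inr f1) => [|z p IHp] x /=; first by move=> _ <-.
by case/andP=> /step xz /IHp{}IHp /IHp h /h /xz.
Qed.

(* If adding an edge to [S] joins two components, then it closes no cycle, so
   removing it from the dual of the complement of [S] separates no faces. *)
Lemma dual_connect_side S u v : adj u v -> ~~ connect (incident S) u v ->
  connect (dual_adj (edges G :\: ([set u; v] |: S))) (side u v) (side v u).
Proof.
move=> uv uvS; set D := dual_adj _; apply: contraT => sep.
(* Every edge leaving [W] other than [uv] lies outside [S], so its two sides are in the same dual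
   component. If [uv] separated its sides, it alone would unbalance the two sums. *)
pose W := [set w | connect (incident S) u w].
have := cut_balance W (connect D (side u v)).
have dE : ((u, v) \in darts) && (((u, v).1 \in W) && ((u, v).2 \notin W)).
  by rewrite !inE /= uv connect0 uvS.
rewrite !(bigD1 (u, v) dE) /= connect0 (negPf sep).
set s1 := \sum_(_ | _) _; set s2 := \sum_(_ | _) _.
suff -> : s1 = s2 by lia.
apply: eq_bigr => -[a b] /=; rewrite !inE /= => /andP[/and3P[ab ua ub] dn].
have dab : D (side a b) (side b a).
  apply/dual_adjP; exists a, b; split=> //; rewrite !inE mem_edges ab andbT negb_or.
  apply/andP; split.
    apply/eqP => /set2_eqP[|] [aE bE]; first by rewrite aE bE eqxx in dn.
    by rewrite aE (negPf uvS) in ua.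
  apply: contra ub => abS; apply: connect_trans ua _; exact: connect1.
congr nat_of_bool; apply/idP/idP => h; apply: connect_trans h (connect1 _) => //.
by rewrite [D _ _]dual_adj_sym.
Qed.

(** Edges are added one at a time, starting from the empty set, where equality of the vertex count
    with the number of components and dual connectedness suffice. An edge within a component adds at
    most one dual component, which [#|S|] pays for; an edge between two components lowers their
    number by at most one and leaves the dual components unchanged. *)
Lemma euler_inequality S : S \subset edges G ->
  #|V| + n_comp (dual_adj (edges G :\: S)) predT
    <= #|S| + n_comp (incident S) predT + 1.
Proof.
have [n] := ubnP #|S|; elim: n S => // n IHn S leSn SE.
have [->|[e eS]] := set_0Vmem S.
  rewrite cards0 setD0 add0n leq_add //.
    rewrite -[#|V|]cardsT -(imset_id setT); apply: card_codom_n_comp => [|a b].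
      exact: incident_sym.
    by rewrite /incident inE.
  by apply: n_comp_connected; apply: dual_connected.
have /edgesP[u [v [uv eE]]] := subsetP SE _ eS.
pose S' := S :\ e; have SS' : S = e |: S' by rewrite setD1K.
have eS' : e \notin S' by rewrite !inE eqxx.
have cS : #|S| = #|S'|.+1 by rewrite SS' cardsU1 eS'.
have {IHn}IH : #|V| + n_comp (dual_adj (edges G :\: S')) predT
    <= #|S'| + n_comp (incident S') predT + 1.
  by apply: IHn; [rewrite -ltnS -cS | apply: subset_trans SE; apply: subD1set].
have new_p a b : incident S a b ->
    [\/ incident S' a b, (a, b) = (u, v) | (a, b) = (v, u)].
  rewrite /incident SS' eE in_setU1 => /orP[/eqP/set2_eqP[]|] h.
  - by constructor 2.
  - by constructor 3.
  - by constructor 1.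
have new_d f1 f2 : dual_adj (edges G :\: S') f1 f2 ->
    [\/ dual_adj (edges G :\: S) f1 f2, (f1, f2) = (side u v, side v u)
      | (f1, f2) = (side v u, side u v)].
  case/dual_adjP=> a [b [ab]]; rewrite inE => /andP[abS' abE] <- <-.
  have [abe|abe] := eqVneq [set a; b] e.
    move: abe; rewrite eE => /set2_eqP[[-> ->]|[-> ->]]; by [constructor 2|constructor 3].
  constructor 1; apply/dual_adjP; exists a, b; split=> //.
  by rewrite SS' inE abE in_setU1 negb_or abe abS'.
have sub_p : subrel (incident S') (incident S).
  by move=> a b; rewrite /incident SS' in_setU1 => ->; rewrite orbT.
have sub_d : subrel (dual_adj (edges G :\: S)) (dual_adj (edges G :\: S')).
  move=> f1 f2 /dual_adjP[a [b [ab]]]; rewrite inE => /andP[abS abE] h1 h2.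
  apply/dual_adjP; exists a, b; split=> //; rewrite inE abE andbT.
  by apply: contra abS; rewrite SS' in_setU1 => ->; rewrite orbT.
have [uvS'|uvS'] := boolP (connect (incident S') u v).
  rewrite -(n_comp_add_inner_edge (@incident_sym S') sub_p new_p uvS').
  have := n_comp_add_edge (@dual_adj_sym _) (@dual_adj_sym _) new_d.
  lia.
have := n_comp_add_edge (@incident_sym S') (@incident_sym S) new_p.
have := dual_connect_side uv uvS'; rewrite -eE -SS'.
move/(n_comp_add_inner_edge (@dual_adj_sym _) sub_d new_d)->.
lia.
Qed.

(** Darts of [f] outside [codom k] have both ends in the same class of [r], so they cancel in
    [face_balance] and only the three darts [k j] remain. *)
Lemma side_balance f (k : 'I_3 -> V * V) (r : V -> V) x : injective k ->
  (forall j, adj (k j).1 (k j).2) -> (forall j, side (k j).1 (k j).2 = f) ->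
  (forall a b, adj a b -> side a b = f -> (a, b) \notin codom k -> r a = r b) ->
  \sum_j (r (k j).1 == x) = \sum_j (r (k j).2 == x).
Proof.
move=> k_inj k_adj k_side r_other; have := face_balance f [set w | r w == x].
have split E : \sum_(d in darts | side d.1 d.2 == f) E d = \sum_j E (k j) +
    \sum_(d in darts | (side d.1 d.2 == f) && (d \notin codom k)) E d :> nat.
  rewrite (bigID (fun d => d \in codom k)) /=; congr (_ + _); last first.
    by apply: eq_bigl => d; rewrite andbA.
  rewrite -(big_imset (h := k) E) /=; last by move=> j j' _ _ /k_inj.
  apply: eq_bigl => d; apply/idP/imsetP => [/andP[_ /codomP[j ->]]|[j _ ->]].
    by exists j.
  by rewrite inE k_adj k_side eqxx codom_f.
rewrite !split /=.
set s1 := \sum_(_ in _ | _) _; set s2 := \sum_(_ in _ | _) _.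
have -> : s1 = s2.
  apply: eq_bigr => -[a b]; rewrite !inE /= => /and3P[ab /eqP abf abk].
  by rewrite (r_other _ _ ab).
by move/addIn; under eq_bigr do rewrite inE; under [RHS]eq_bigr do rewrite inE.
Qed.

(** A nonempty even subgraph of K_{3,3} contains a cycle, hence at least four edges. The proof
    enumerates all grids. *)
Lemma even_grid (d : 'I_3 -> 'I_3 -> bool) :
  (forall i, ~~ odd (\sum_j d i j)) -> (forall j, ~~ odd (\sum_i d i j)) ->
  (exists i j, d i j) -> 4 <= \sum_i \sum_j d i j.
Proof.
move=> row col [i [j dij]]; pose o0 : 'I_3 := ord0.
pose o1 : 'I_3 := lift ord0 ord0; pose o2 : 'I_3 := lift ord0 (lift ord0 ord0).
have sumE F : \sum_(k < 3) F k = F o0 + (F o1 + F o2).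
  by rewrite !big_ord_recl big_ord0 addn0.
have ordE k : [\/ k = o0, k = o1 | k = o2].
  case: k => -[|[|[|//]]] lt3; [constructor 1|constructor 2|constructor 3]; exact: val_inj.
have := (row o0, row o1, row o2, col o0, col o1, col o2).
rewrite !sumE.
have : [|| d o0 o0, d o0 o1, d o0 o2, d o1 o0, d o1 o1, d o1 o2, d o2 o0, d o2 o1 | d o2 o2].
  by move: dij; case: (ordE i) => ->; case: (ordE j) => -> ->; rewrite ?orbT.
by case: (d o0 o0); case: (d o0 o1); case: (d o0 o2) => //;
   case: (d o1 o0); case: (d o1 o1); case: (d o1 o2) => //;
   case: (d o2 o0); case: (d o2 o1); case: (d o2 o2) => // _ [[[[[]]]]].
Qed.

(** * Nine edges whose duals form a K_{3,3} *)

Section DualK33.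
Variables (F H : 'I_3 -> face G) (k : 'I_3 -> 'I_3 -> V * V).
Hypotheses (F_inj : injective F) (H_inj : injective H) (FH : forall i j, F i <> H j).
Hypothesis k_adj : forall i j, adj (k i j).1 (k i j).2.
Hypothesis k_right : forall i j, side (k i j).1 (k i j).2 = F i.
Hypothesis k_left : forall i j, side (k i j).2 (k i j).1 = H j.

Let K : {set {set V}} := [set [set (k p.1 p.2).1; (k p.1 p.2).2] | p : 'I_3 * 'I_3].

Let mem_K a b : [set a; b] \in K -> exists i j, k i j = (a, b) \/ k i j = (b, a).
Proof.
case/imsetP=> -[i j] _ /= /set2_eqP abE; exists i, j.
by case: (k i j) abE => u v /= [[-> ->]|[-> ->]]; [left|right].
Qed.

(** The faces on the two sides of an edge determine [i] and [j]; a coincidence with reversed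
    orientation would equate some [F i] with some [H j]. *)
Let card_K : #|K| = 9.
Proof.
rewrite card_imset ?card_prod ?card_ord // => -[i j] [i' j'] /= /set2_eqP E.
have := (k_right i j, k_left i j, k_right i' j', k_left i' j').
case: (k i j) (k i' j') E => a b [a' b'] /= [[-> ->]|[-> ->]] [[[-> ->]]].
  by move=> /F_inj-> /H_inj->.
by move=> /esym/FH.
Qed.

Let sub_K : K \subset edges G.
Proof. by apply/subsetP => _ /imsetP[p _ ->]; rewrite mem_edges k_adj. Qed.

(* The dual edges of [K] only join the six faces [F i] and [H j]. *)
Let dual_components : #|face G| <= n_comp (dual_adj K) predT + 5.
Proof.
pose X := F @: setT :|: H @: setT.
(* [h] merges the six faces into one, so it keeps at least [#|face G| - 5] values. *)
pose h f := if f \in X then F ord0 else f.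
have hK f1 f2 : dual_adj K f1 f2 -> h f1 = h f2.
  case/dual_adjP=> a [b [ab /mem_K[i [j kE]] <- <-]].
  have := (k_right i j, k_left i j); rewrite /h.
  by case: kE => -> /= [-> ->]; rewrite !inE !imset_f ?orbT.
apply: leq_trans (leq_add (card_codom_n_comp (@dual_adj_sym _) hK) (leqnn 5)).
have : #|X| <= 6.
  apply: leq_trans (leq_card_setU _ _) _.
  by rewrite !card_imset // cardsT card_ord.
have : #|F ord0 |: ~: X| <= #|h @: setT|.
  apply/subset_leq_card/subsetP => f; rewrite in_setU1 => /orP[/eqP->|fX].
    by apply/imsetP; exists (F ord0); rewrite // /h !inE imset_f.
  by apply/imsetP; exists f; rewrite // /h; move: fX; rewrite inE => /negPf->.
have -> : #|F ord0 |: ~: X| = #|~: X|.+1 by rewrite cardsU1 !inE imset_f.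
have := cardsC X; lia.
Qed.

Let S := edges G :\: K.

(** Subtracting Euler's formula from the inequality for [S] leaves a gain of 9 from the edges of [K]
    and a loss of 5 from [dual_components]. *)
Let many_components : n_comp (@adj G) predT + 4 <= n_comp (incident S) predT.
Proof.
have := euler_inequality (subsetDl (edges G) K).
rewrite setDDr setDv set0U (setIidPr sub_K) -/S.
have := cardsID K (edges G); rewrite (setIidPr sub_K) card_K -/S.
have : #|V| + #|face G| = #|edges G| + n_comp (@adj G) predT + 1 by apply: pg_euler.
move: dual_components; lia.
Qed.

Let r := root (incident S).
Let crossing x i j := (r (k i j).1 == x) != (r (k i j).2 == x).

Let same_root a b : adj a b -> [set a; b] \notin K -> r a = r b.
Proof.
move=> ab abK; apply/eqP; rewrite root_connect ?connect1 //.
  by rewrite /incident inE abK mem_edges.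
exact/sym_connect_sym/incident_sym.
Qed.

Let row_balance x i : \sum_j (r (k i j).1 == x) = \sum_j (r (k i j).2 == x).
Proof.
apply: (@side_balance (F i) (k i)) => // [j j' E|a b ab abF abk].
  by apply: H_inj; rewrite -(k_left i) -(k_left i) E.
apply: (same_root ab); apply: contra abk => /mem_K[i' [j' [E|E]]].
  have := k_right i' j'; rewrite E /= abF => /F_inj ii'.
  by apply/codomP; exists j'; rewrite ii' E.
by have := k_left i' j'; rewrite E /= abF => /FH.
Qed.

(** The darts are reversed so that [H j] lies on their right. *)
Let col_balance x j : \sum_i (r (k i j).2 == x) = \sum_i (r (k i j).1 == x).
Proof.
apply: (@side_balance (H j) (fun i => ((k i j).2, (k i j).1))) => //.
- by move=> i i' [E1 E2]; apply: F_inj; rewrite -(k_right i j) -(k_right i' j) E1 E2.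
- by move=> i /=; rewrite adj_sym.
- by move=> i /=.
move=> a b ab abH abk.
apply: (same_root ab); apply: contra abk => /mem_K[i' [j' [E|E]]].
  by have := k_right i' j'; rewrite E /= abH => /esym/FH.
have := k_left i' j'; rewrite E /= abH => /H_inj jj'.
by apply/codomP; exists i'; rewrite jj' E.
Qed.

Let odd_crossing (I : finType) (p q : pred I) :
  \sum_i p i = \sum_i q i :> nat -> ~~ odd (\sum_i (p i != q i)).
Proof.
move=> pq; suff -> : odd (\sum_i (p i != q i)) = odd (\sum_i p i + \sum_i q i).
  by rewrite pq addnn odd_double.
rewrite -big_split /=; apply: (big_rec2 (fun a b => odd a = odd b)) => // i a b _.
by rewrite !oddD => ->; case: (p i); case: (q i).
Qed.

Let crossing_ge4 x : (exists i j, crossing x i j) -> 4 <= \sum_i \sum_j crossing x i j.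
Proof.
apply: even_grid => [i|j]; first exact: odd_crossing (row_balance x i).
exact: odd_crossing (esym (col_balance x j)).
Qed.

(** Each of the nine edges leaves at most two components, those of its ends. *)
Let crossing_total : \sum_(x | roots (incident S) x) \sum_i \sum_j crossing x i j <= 18.
Proof.
rewrite exchange_big /=; under eq_bigr do rewrite exchange_big /=.
have le2 i j : \sum_(x | roots (incident S) x) crossing x i j <= 2.
  apply: leq_trans (_ : \sum_(x in [set r (k i j).1; r (k i j).2]) 1 <= _); last first.
    by rewrite sum1_card cards2; case: (_ != _).
  rewrite big_mkcond [X in _ <= X]big_mkcond; apply: leq_sum => x _.
  rewrite /crossing !inE ![x == _]eq_sym.
  by case: (roots _ x); case: (_ == x); case: (_ == x).
apply: leq_trans (_ : \sum_(i < 3) \sum_(j < 3) 2 <= _).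
  by apply: leq_sum => i _; apply: leq_sum => j _.
by rewrite !sum_nat_const !card_ord.
Qed.

Lemma dual_K33 : False.
Proof.
have sym := sym_connect_sym (@incident_sym S).
have adj_csym := sym_connect_sym (@adj_sym G).
pose R := [set x | roots (incident S) x].
pose crossed x := [exists i, exists j, crossing x i j].
(* A component of [S] that no edge of [K] leaves is a whole component of [G]. *)
have uncrossed x y : roots (incident S) x -> roots (incident S) y -> ~~ crossed x ->
    root (@adj G) x = root (@adj G) y -> x = y.
  move=> rx ry xn /eqP; rewrite root_connect // => xy.
  have stable a b : adj a b -> (r a == x) = (r b == x).
    move=> ab; have [/mem_K[i [j kE]]|abK] := boolP ([set a; b] \in K); last first.
      by rewrite (same_root ab).
    have : ~~ crossing x i j.
      by apply: contra xn => h; apply/existsP; exists i; apply/existsP; exists j.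
    by rewrite /crossing negbK; case: kE => -> /= /eqP.
  have := connect_invariant (h := fun a => r a == x) stable xy.
  by rewrite /r (eqP rx) (eqP ry) eqxx => /esym/eqP.
pose U := [set x in R | ~~ crossed x].
have card_adj : n_comp (@adj G) predT = #|[set x | roots (@adj G) x]| by apply: n_comp_predT.
have lt_R : #|[set x | roots (@adj G) x]| < #|R|.
  by have := many_components; rewrite card_adj n_comp_predT -/R; lia.
have inj_card (A : {set V}) : {in A &, injective (root (@adj G))} ->
    #|A| <= #|[set x | roots (@adj G) x]|.
  move=> inj; rewrite -(card_in_imset inj); apply/subset_leq_card/subsetP.
  by move=> _ /imsetP[x _ ->]; rewrite inE roots_root.
(* Without a crossed component, [S] would have no more components than [G]. *)
have [x0 x0R x0c] : exists2 x, x \in R & crossed x.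
  apply/exists_inP; apply: contraLR lt_R => /exists_inPn none.
  rewrite -leqNgt; apply: inj_card => x y xR yR.
  by have := none x xR; move: xR yR; rewrite !inE => ? ? ?; apply: uncrossed.
(* The component of [G] around [x0] contains no member of [U], whence the strict inequality and at
   least five crossed components. *)
have le_U : #|U| < #|[set x | roots (@adj G) x]|.
  have <- : #|x0 |: U| = #|U|.+1 by rewrite cardsU1 !inE x0c andbF.
  apply: inj_card => x y; rewrite !in_setU1 => /orP[/eqP->|xU] /orP[/eqP->|yU] //.
  - by move: x0R yU; rewrite !inE => ? /andP[? ?] /esym/uncrossed->.
  - by move: x0R xU; rewrite !inE => ? /andP[? ?]; apply: uncrossed.
  - by move: xU yU; rewrite !inE => /andP[? ?] /andP[? ?]; apply: uncrossed.
have : 4 * #|[set x in R | crossed x]| <= 18.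
  apply: leq_trans crossing_total; rewrite mulnC -sum_nat_const.
  rewrite big_mkcond [X in _ <= X]big_mkcond; apply: leq_sum => x _.
  rewrite !inE; case: (roots _ x) => //=; case: ifP => // /existsP[i /existsP[j xij]].
  by apply: crossing_ge4; exists i, j.
have := many_components; rewrite card_adj n_comp_predT -/R.
have : #|R| = #|[set x in R | crossed x]| + #|U|.
  rewrite -(cardsID [set x | crossed x] R); congr (_ + _); apply: eq_card => x;
    by rewrite !inE // andbC.
lia.
Qed.

End DualK33.
End PlaneGraph.

(** * Flipping cells *)

Lemma cycle_two_edges (G : plane_graph) (C : {set {set vertex G}}) v :
  is_cycle C -> v \in cover C ->
  exists e1 e2, [/\ e1 \in C, e2 \in C, e1 != e2, v \in e1 & v \in e2].
Proof.
case=> s [s_gt2 /andP[_ s_uniq] ->] vC.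
have vs : v \in s.
  case/bigcupP: vC => _ /imsetP[x xs ->]; rewrite !inE.
  by case/orP=> /eqP->; rewrite ?mem_next.
(* Otherwise two steps along the cycle would return to [v], although it has more than two
   vertices. *)
have next_prev_neq : next s v != prev s v.
  apply: contraTneq isT => E; have {E} : next s (next s v) = v by rewrite E next_prev.
  have [i s' sE] := rot_to vs; rewrite -!(next_rot i s_uniq).
  move: s_uniq s_gt2; rewrite -(rot_uniq i) -(size_rot i) sE.
  case: s' {sE} => [|y [|z s']] //=; rewrite !inE !negb_or => /andP[/and3P[vy vz _] _] _.
  by rewrite eqxx eq_sym (negPf vy) eqxx => zv; rewrite zv eqxx in vz.
exists [set v; next s v], [set prev s v; v]; split; rewrite ?set21 ?set22 //.
- exact: imset_f.
- by apply/imsetP; exists (prev s v); rewrite ?mem_prev ?next_prev.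
by apply: contra_neq next_prev_neq => /set2_eqP[[<- ->]|[->]].
Qed.

Section Matchings.
Variables (G : plane_graph) (c : vertex G -> bool).
Hypothesis c_proper : proper_coloring c.
Local Notation V := (vertex G).
Implicit Types (u v w : V) (M N C : {set {set V}}) (e : {set V}) (f g : face G).

Lemma mem_boundary f u v :
  ([set u; v] \in boundary f) = adj u v && ((side u v == f) || (side v u == f)).
Proof.
apply/imsetP/andP => [[[a b]]|[uv /orP[h|h]]].
- rewrite inE /= => /andP[ab /eqP<-] /set2_eqP[[-> ->]|[-> ->]].
    by rewrite ab eqxx.
  by rewrite adj_sym ab eqxx orbT.
- by exists (u, v); rewrite ?inE /= ?uv.
- by exists (v, u); [rewrite inE /= adj_sym uv | apply: setUC].
Qed.

Lemma boundaryP f e : e \in boundary f ->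
  exists u v, [/\ adj u v, side u v = f & e = [set u; v]].
Proof. by case/imsetP=> -[u v]; rewrite inE => /andP[? /eqP ?] ->; exists u, v. Qed.

Lemma boundary_edges f : boundary f \subset edges G.
Proof. by apply/subsetP => _ /boundaryP[u [v [uv _ ->]]]; rewrite mem_edges. Qed.

Lemma in_symdiff M N e : (e \in symdiff M N) = (e \in M) (+) (e \in N).
Proof. by rewrite !inE; case: (e \in M); case: (e \in N). Qed.

(** The last step of a dual path from [outer G] to [f] would cross an edge of [boundary f]. *)
Lemma inside_boundary f : f <> outer G -> inside (boundary f) f.
Proof.
move=> f_inner; apply/negP => /connectP[p]; case/lastP: p => [_ /f_inner //|p z].
rewrite rcons_path last_rcons => /andP[_ pz] fz; move: pz; rewrite -fz.
case/existsP=> u /existsP[v /and4P[uv uvf _ vuf]].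
by rewrite mem_boundary uv vuf orbT in uvf.
Qed.

Local Notation perfect M := (perfect_matching setT (edges G) M).

Lemma perfect_sub M : perfect M -> M \subset edges G.
Proof. by case/andP. Qed.

Lemma perfect_exists M v : perfect M -> exists2 e, e \in M & v \in e.
Proof.
case/andP=> _ /and3P[/eqP cM _ _]; have: v \in cover M by rewrite cM.
by case/bigcupP=> e; exists e.
Qed.

Lemma perfect_unique M v e1 e2 : perfect M ->
  e1 \in M -> e2 \in M -> v \in e1 -> v \in e2 -> e1 = e2.
Proof.
case/andP=> _ /and3P[_ /trivIsetP tM _] M1 M2 v1 v2.
apply: contraTeq v2 => /(tM _ _ M1 M2)/disjointFr; exact: (fun h => negbT (h v v1)).
Qed.

(** Being covered exactly once concerns only the edges at one vertex, so [M] may be glued from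
    different perfect matchings. *)
Lemma perfect_local M : M \subset edges G ->
  (forall v, exists2 N, perfect N & forall e, v \in e -> (e \in M) = (e \in N)) ->
  perfect M.
Proof.
move=> ME loc; rewrite /perfect_matching ME /=; apply/and3P; split.
- apply/eqP/setP => v; rewrite inE; have [N pN NM] := loc v.
  have [e eN ve] := perfect_exists v pN.
  by apply/bigcupP; exists e; rewrite ?NM.
- apply/trivIsetP => e1 e2 M1 M2; apply: contraNT => /pred0Pn[v /andP[/= v1 v2]].
  by have [N pN NM] := loc v; rewrite !NM // in M1 M2; rewrite (perfect_unique pN M1 M2 v1).
- by apply/negP => /(subsetP ME)/edgesP[u [v [_ /setP/(_ u)]]]; rewrite !inE eqxx.
Qed.

Lemma alternating_edges M C v : alternating M C -> v \in cover C ->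
  exists e1 e2, [/\ e1 \in C, e2 \in C, v \in e1, v \in e2 & (e1 \in M) && (e2 \notin M)].
Proof.
case=> cC alt /(cycle_two_edges cC)[e1 [e2 [C1 C2 ne v1 v2]]].
have := alt e1 e2 C1 C2 ne; have -> : ~~ [disjoint e1 & e2].
  by apply/pred0Pn; exists v; rewrite /= v1.
move=> /(_ isT); case M1: (e1 \in M); case M2: (e2 \in M) => // _.
  by exists e1, e2; rewrite M1 M2.
by exists e2, e1; rewrite M1 M2.
Qed.

(** This is [Zarc] with its cell exposed, on bare edge sets so that it applies before [M] and [N]
    are packed as elements of [matching]. *)
Definition flip f M N := [/\ cell f, symdiff M N = boundary f
  & proper_alternating c M (boundary f)].

Lemma cell_dart f : cell f -> exists u v, adj u v /\ side u v = f.
Proof.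
case=> _ [[|x s] [// _ _ E]].
have : [set x; next (x :: s) x] \in boundary f.
  by rewrite E; apply/imsetP; exists x; rewrite ?mem_head.
by case/boundaryP=> u [v [uv uvf _]]; exists u, v.
Qed.

(** If the edge is in [M], properness makes [u] white. Otherwise the next edge along [f] is in [M]
    by alternation, so [v] is white and [u] black. *)
Lemma flip_source f M N u v : flip f M N -> adj u v -> side u v = f ->
  ([set u; v] \in M) = c u.
Proof.
case=> -[f_inner f_cycle] _ [[_ alt] white] uv uvf.
have uvC : [set u; v] \in boundary f by rewrite mem_boundary uv uvf eqxx.
have in_f := inside_boundary f_inner.
have vu : adj v u by rewrite adj_sym.
have [uvM|uvM] := boolP ([set u; v] \in M).
  by case: (white u v) => //; rewrite uvf.
set w := rot v u; have vw : adj v w by apply: rot_adj.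
have vwf : side v w = f by rewrite side_rot.
have vwC : [set v; w] \in boundary f by rewrite mem_boundary vw vwf eqxx.
(* If the walk turned back at [v], then [u] would be the only neighbour of [v], but two boundary
   edges meet there. *)
have wu : w != u.
  apply/eqP => wu; have vC : v \in cover (boundary f).
    by apply/bigcupP; exists [set u; v]; rewrite // set22.
  have [e1 [e2 [C1 C2]]] := cycle_two_edges f_cycle vC.
  have uniq_nbr a : adj v a -> a = u.
    move/(rot_cyclic vu)/iter_findex <-; elim: (findex _ _ _) => //= n ->; exact: wu.
  have at_v e : e \in boundary f -> v \in e -> e = [set v; u].
    case/boundaryP=> a [b [ab _ ->]]; rewrite !inE => /orP[]/eqP E.
      by rewrite -E in ab *; rewrite (uniq_nbr b).
    by rewrite -E adj_sym in ab *; rewrite (uniq_nbr a) // setUC.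
  by move=> ne v1 v2; rewrite (at_v e1) // (at_v e2) // eqxx in ne.
have ne : [set u; v] != [set v; w].
  apply/eqP => /set2_eqP[[uE vE]|[uE]]; last by rewrite -uE eqxx in wu.
  by move: uv; rewrite uE adj_irr.
have meet : ~~ [disjoint [set u; v] & [set v; w]].
  by apply/pred0Pn; exists v; rewrite /= set21 set22.
have := alt _ _ uvC vwC ne meet; rewrite (negPf uvM) => vwM.
have [cv _] : c v /\ ~~ c w.
  by apply: white => //; [rewrite vwf | case: (_ \in M) vwM].
by have := c_proper uv; rewrite cv; case: (c u).
Qed.

Lemma flip_target f M N u v : flip f M N -> adj u v -> side u v = f ->
  ([set u; v] \in N) = ~~ c u.
Proof.
move=> fl uv uvf; rewrite -(flip_source fl uv uvf); case: fl => _ /setP/(_ [set u; v]) + _.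
rewrite in_symdiff mem_boundary uv uvf eqxx /=.
by case: (_ \in M); case: (_ \in N).
Qed.

Lemma flip_one_side f M N u v : flip f M N -> adj u v -> side u v = f -> side v u <> f.
Proof.
move=> fl uv uvf vuf; have vu : adj v u by rewrite adj_sym.
have := c_proper uv; rewrite -(flip_source fl uv uvf) -(flip_source fl vu vuf).
by rewrite setUC eqxx.
Qed.

(** A flip exchanges the colors from which matched edges start along [f], so [f] cannot be flipped
    again at once. *)
Lemma flip_consecutive f g M N P : flip f M N -> flip g N P -> f <> g.
Proof.
move=> flf flg fg; have [cf _ _] := flf; have [u [v [uv uvf]]] := cell_dart cf.
have := flip_target flf uv uvf; rewrite (flip_source flg uv) -?fg //.
by case: (c u).
Qed.

(* [n f] counts how often the face [f] is flipped on the way from [M] to [N]. *)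
Definition height M N (n : face G -> nat) := n (outer G) = 0 /\
  forall u v, adj u v -> c u ->
    ([set u; v] \in M) + n (side v u) = ([set u; v] \in N) + n (side u v).

(** Directed from its white end, an edge leaves the matching when [f] is on its right and enters it
    when [f] is on its left; both cannot occur. *)
Lemma flip_height f M N : flip f M N -> height M N (fun g => g == f).
Proof.
move=> fl; have [[f_inner _] /setP fE _] := fl; split.
  by case: eqP => // /esym.
move=> u v uv cu; have vu : adj v u by rewrite adj_sym.
have := c_proper uv; rewrite cu => cv.
have [uvf|uvf] := eqVneq (side u v) f.
  have /eqP/negPf-> := flip_one_side fl uv uvf.
  by rewrite (flip_source fl uv uvf) (flip_target fl uv uvf) cu.
have [vuf|vuf] := eqVneq (side v u) f.
  by rewrite setUC (flip_source fl vu vuf) (flip_target fl vu vuf); case: (c v) cv.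
have := fE [set u; v]; rewrite in_symdiff mem_boundary uv (negPf uvf) (negPf vuf).
by case: (_ \in M); case: (_ \in N).
Qed.

Lemma height_trans M N P n m :
  height M N n -> height N P m -> height M P (fun f => n f + m f).
Proof.
move=> [n0 hn] [m0 hm]; split=> [|u v uv cu]; first by rewrite n0 m0.
by have := hn u v uv cu; have := hm u v uv cu; lia.
Qed.

(** The matchings fix the difference of a height across each edge; the value at [outer G] and
    connectedness of the dual fix the rest. *)
Lemma height_unique M N n m : height M N n -> height M N m -> n =1 m.
Proof.
move=> [n0 hn] [m0 hm] f.
have step f1 f2 : dual_adj (edges G) f1 f2 -> (n f1 == m f1) = (n f2 == m f2).
  case/dual_adjP=> u [v [uv _ <- <-]].
  have := c_proper uv; case cu: (c u) => /= cv.
    by have := hn u v uv cu; have := hm u v uv cu; lia.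
  have vu : adj v u by rewrite adj_sym.
  have {}cv : c v by case: (c v) cv.
  by have := hn v u vu cv; have := hm v u vu cv; lia.
have := connect_invariant (h := fun f => n f == m f) step (dual_connected (outer G) f).
by rewrite n0 m0 => /esym/eqP.
Qed.

Lemma Zle_height (M N : matching G) : Zle c N M -> exists n, height (val M) (val N) n.
Proof.
elim=> {M N} [M N [f fl]|M|M N P _ [n hn] _ [m hm]].
- by exists (fun g => g == f); apply: flip_height fl.
- by exists (fun=> 0).
- by exists (fun f => n f + m f); apply: height_trans hm.
Qed.

Lemma disjoint_cover_notin f g e : [disjoint cover (boundary f) & cover (boundary g)] ->
  e \in boundary f -> e \notin boundary g.
Proof.
move=> dis ef; apply/negP => eg; have [u [v [_ _ eE]]] := boundaryP ef.
have uf : u \in cover (boundary f) by apply/bigcupP; exists e; rewrite // eE set21.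
have : u \in cover (boundary g) by apply/bigcupP; exists e; rewrite // eE set21.
by rewrite (disjointFr dis uf).
Qed.

(** [Q] is [M] with [g] flipped. At the vertices of [f] it agrees with [M], and at all others with
    [P]. *)
Lemma flip_commute f g M N P : perfect M -> perfect N -> perfect P ->
  flip f M N -> flip g N P -> [disjoint cover (boundary f) & cover (boundary g)] ->
  let Q := symdiff P (boundary f) in perfect Q /\ flip f Q P.
Proof.
move=> pM pN pP [cf /setP fE [[f_cycle alt] white]] [cg /setP gE _] dis Q.
have QM e : e \notin boundary g -> (e \in Q) = (e \in M).
  move=> eg; have := fE e; have := gE e; rewrite !in_symdiff (negPf eg).
  by case: (e \in M); case: (e \in N); case: (e \in P); case: (e \in boundary f).
have QMf e : e \in boundary f -> (e \in Q) = (e \in M).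
  by move/(disjoint_cover_notin dis)/QM.
split; last first.
  split=> //; first by apply/setP => e; rewrite !in_symdiff; case: (e \in P); case: (_ \in boundary f).
  split; first by split=> // e1 e2 f1 f2; rewrite !QMf //; apply: alt.
  by move=> u v uv uvf; rewrite QMf //; apply: white.
apply: perfect_local => [|v].
  apply/subsetP => e; rewrite in_symdiff; case eP: (e \in P) => /=.
    by rewrite (subsetP (perfect_sub pP)).
  by move/(subsetP (boundary_edges f)).
have [vf|vf] := boolP (v \in cover (boundary f)).
  exists M => // e ve; apply: QM; apply/negP => eg.
  have : v \in cover (boundary g) by apply/bigcupP; exists e.
  by rewrite (disjointFr dis vf).
exists P => // e ve; rewrite in_symdiff; have [ef|_] := boolP (e \in boundary f).
  by case/bigcupP: vf; exists e.
by rewrite addbF.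
Qed.

(** At a common vertex, each of the two boundaries has an edge of [N]. As [N] is perfect these edges
    coincide, and [f] and [g] lie on opposite sides. *)
Lemma flip_common_dart f g M N P : perfect N ->
  flip f M N -> flip g N P -> ~~ [disjoint cover (boundary f) & cover (boundary g)] ->
  exists d : V * V, [/\ adj d.1 d.2, side d.1 d.2 = f & side d.2 d.1 = g].
Proof.
move=> pN flf flg /pred0Pn[v /andP[/= vf vg]].
have fg := flip_consecutive flf flg.
have [[cf /setP fE [altf _]] [cg _ [altg _]]] := (flf, flg).
have [_ [e [_ ef _ ve /andP[_ eM]]]] := alternating_edges altf vf.
have [e' [_ [eg _ ve' _ /andP[eN' _]]]] := alternating_edges altg vg.
have eN : e \in N by have := fE e; rewrite in_symdiff ef (negPf eM).
rewrite -(perfect_unique pN eN eN' ve ve') in eg.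
have [a [b [ab abf eE]]] := boundaryP ef; exists (a, b); split=> //=.
move: eg; rewrite eE mem_boundary ab abf => /orP[]/eqP //.
Qed.

End Matchings.

(** * Covering relation *)

Section Covers.
Variables (disp : Order.disp_t) (L : finDistrLatticeType disp).
Implicit Types x y z : L.

Lemma covered_by_exists y z : (y < z)%O -> exists2 w, covered_by y w & (w <= z)%O.
Proof.
move=> yz; pose P w := (y < w)%O && (w <= z)%O.
have Pz : P z by rewrite /P yz lexx.
(* A candidate with the fewest elements below it is a cover. *)
case: (arg_minnP (fun w => #|[set t : L | (t <= w)%O]|) Pz) => w /andP[yw wz] min_w.
exists w => //; rewrite /covered_by yw; apply/forallP => t; apply/negP => /andP[yt tw].
have tz : (t <= z)%O by apply: le_trans wz; apply: ltW.
have := min_w t; rewrite /P yt tz => /(_ isT); apply/negP; rewrite -ltnNge.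
apply: proper_card; apply/properP; split.
  apply/subsetP => s; rewrite !inE => st; apply: le_trans st _.
  exact: ltW.
exists w; rewrite !inE ?lexx //.
by rewrite lt_geF.
Qed.

Lemma meet_irreducible_above x y z :
  meet_irreducible y -> covered_by y x -> (y < z)%O -> (x <= z)%O.
Proof.
case/cards1P=> x' /setP up yx /covered_by_exists[w yw wz].
by move: (up x) (up w); rewrite !inE yx yw => /esym/eqP-> /esym/eqP<-.
Qed.

Variables (G : plane_graph) (c : vertex G -> bool) (phi : L -> matching G).
Hypotheses (c_proper : proper_coloring c) (phi_bij : bijective phi).
Hypothesis phi_le : forall x y, (x <= y)%O <-> Zle c (phi x) (phi y).

(** The first arc on a path from [phi y] to [phi x] ends between the two and changes the matching,
    so it already ends at [phi x]. *)
Lemma covered_by_flip x y : covered_by x y ->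
  exists f, flip c f (val (phi y)) (val (phi x)).
Proof.
case/andP=> xy /forallP no_between; have [psi phiK psiK] := phi_bij.
have /phi_le/clos_rt_rt1n_iff := ltW xy.
move E : (phi y) => My; move E' : (phi x) => Mx path.
case: path E' => [|N' P [f fl] rest] E'.
  have /(bij_inj phi_bij) xyE : phi x = phi y by rewrite E.
  by rewrite xyE ltxx in xy.
exists f; suff -> : P = N' by [].
have xN' : (x <= psi N')%O by apply/phi_le; rewrite psiK E'; apply/clos_rt_rt1n_iff.
have N'y : (psi N' <= y)%O by apply/phi_le; rewrite psiK E; apply: rt_step; exists f.
have N'y_neq : psi N' != y.
  apply/eqP => N'yE; have NE : My = N' by rewrite -E -N'yE psiK.
  have [cf /setP fE _] := fl; have [u [v [uv uvf]]] := cell_dart cf.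
  by have := fE [set u; v]; rewrite NE in_symdiff addbb mem_boundary uv uvf eqxx.
have := no_between (psi N').
rewrite !lt_neqAle N'y_neq N'y xN' !andbT negbK => /eqP xE.
by rewrite -E' xE psiK.
Qed.

(** If the boundaries were disjoint, flipping [f] backwards from [phi y] would give [Q] above [y],
    hence above [x]. A path from [Q] through [phi x] to [phi y] flips [g], whereas the direct flip
    uses only [f]; this contradicts [height_unique]. *)
Lemma cells_share_edge x y z f g :
  covered_by y x -> meet_irreducible y ->
  flip c f (val (phi z)) (val (phi x)) -> flip c g (val (phi x)) (val (phi y)) ->
  exists d : vertex G * vertex G,
    [/\ adj d.1 d.2, side d.1 d.2 = f & side d.2 d.1 = g].
Proof.
move=> yx irr flf flg; have [psi phiK psiK] := phi_bij.
have [dis|] := boolP [disjoint cover (boundary f) & cover (boundary g)]; last first.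
  exact: (flip_common_dart c_proper (valP (phi x)) flf flg).
have fg := flip_consecutive c_proper flf flg.
have [pQ flQ] := flip_commute (valP _) (valP _) (valP _) flf flg dis.
pose Q : matching G := Sub _ pQ.
have yQ : (y <= psi Q)%O by apply/phi_le; rewrite psiK; apply: rt_step; exists f.
have {yQ}yQ : (y < psi Q)%O.
  (* Were [Q] equal to [phi y], the zero height would compete with the height of the flip, which is
     1 at [f]. *)
  rewrite lt_neqAle yQ andbT; apply/eqP => yE.
  have := height_unique c_proper (flip_height c_proper flQ) (m := fun=> 0).
  have -> : symdiff (val (phi y)) (boundary f) = val (phi y) by rewrite {2}yE psiK.
  by move=> /(_ _ f); rewrite eqxx => h; have := h (conj erefl (fun _ _ _ _ => erefl)).
have /phi_le := meet_irreducible_above irr yx yQ; rewrite psiK.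
case/(Zle_height c_proper)=> n hn.
have := height_unique c_proper (height_trans hn (flip_height c_proper flg)) (flip_height c_proper flQ) g.
by rewrite eqxx; case: eqP => [/esym //|_]; lia.
Qed.

End Covers.

Theorem theorem4p2 (disp : Order.disp_t) (L : finDistrLatticeType disp) (x : L)
    (h_up : 3 <= #|[set y : L | covered_by x y]|)
    (h_down : 3 <= #|[set y : L | covered_by y x && meet_irreducible y]|) :
  ~ matchable L.
Proof.
case=> G [c [c_proper _ _ [phi [phi_bij phi_le]]]].
have three (A : {set L}) : 3 <= #|A| ->
    exists2 y : 'I_3 -> L, injective y & forall i, y i \in A.
  move=> A3; exists (fun i => enum_val (widen_ord A3 i)) => [i j|i]; last exact: enum_valP.
  by move/enum_val_inj => E; apply/val_inj/(congr1 val E).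
have [z z_inj zP] := three _ h_up; have [y y_inj yP] := three _ h_down.
have /fin_all_exists[F flF] i : exists f, flip c f (val (phi (z i))) (val (phi x)).
  by apply: (covered_by_flip phi_bij phi_le); have := zP i; rewrite inE.
have yx j : covered_by (y j) x by have := yP j; rewrite inE => /andP[].
have irr j : meet_irreducible (y j) by have := yP j; rewrite inE => /andP[].
have /fin_all_exists[H flH] j : exists g, flip c g (val (phi x)) (val (phi (y j))).
  exact: (covered_by_flip phi_bij phi_le (yx j)).
have /fin_all_exists[k kP] (p : 'I_3 * 'I_3) : exists d : vertex G * vertex G,
    [/\ adj d.1 d.2, side d.1 d.2 = F p.1 & side d.2 d.1 = H p.2].
  exact: (cells_share_edge c_proper phi_bij phi_le (yx p.2) (irr p.2) (flF p.1) (flH p.2)).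
(* A flip is determined by its cell and one end, so distinct neighbours of [x] on the same side give
   distinct cells. *)
have symdiff_inj (M N P : {set {set vertex G}}) : symdiff M P = symdiff N P -> M = N.
  move=> /setP E; apply/setP => e; have := E e; rewrite !in_symdiff.
  by case: (e \in P); rewrite ?addbT ?addbF // => /negb_inj.
have symdiffC (M N : {set {set vertex G}}) : symdiff M N = symdiff N M.
  by rewrite /symdiff setUC.
apply: (@dual_K33 G F H (fun i j => k (i, j))).
- move=> i i' E; apply/z_inj/(bij_inj phi_bij)/val_inj/(symdiff_inj _ _ (val (phi x))).
  by have [_ -> _] := flF i; have [_ -> _] := flF i'; rewrite E.
- move=> j j' E; apply/y_inj/(bij_inj phi_bij)/val_inj/(symdiff_inj _ _ (val (phi x))).
  rewrite ![symdiff (val (phi (y _))) _]symdiffC.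
  by have [_ -> _] := flH j; have [_ -> _] := flH j'; rewrite E.
- by move=> i j; apply: (flip_consecutive c_proper (flF i) (flH j)).
- by move=> i j; have [] := kP (i, j).
- by move=> i j; have [] := kP (i, j).
- by move=> i j; have [] := kP (i, j).
Qed.
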